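(* Let $N>0$, $\tau\in(0,1)$, and let $(v_1,v_2)$ be a radial solution of $(P)_\tau$ as described in the context, with flux pair $(\beta_1,\beta_2)$. Then: (i) If $\tau\in(0,\frac12)$, then $\beta_i\le\beta_i^*(\tau)$ for $i=1,2$, and $\beta_2=\varphi_1^+(\beta_1)\ge\max\{\beta_2^{**}(\tau),4\}$; equivalently, $\beta_1=\varphi_2^+(\beta_2)\ge\max\{\beta_1^{**}(\tau),4(N+1)\}$. (ii) If $\tau\in(\frac12,\tau_1^{(2)})$, then $\beta_2\le\beta_2^{**}(\tau)$ and $\beta_1\ge\beta_1^*(\tau)>4(N+1)$. (iii) If $\tau\in(\frac12,\tau_1^{(1)})$, then $\beta_1\le\beta_1^{**}(\tau)$ and $\beta_2\ge\beta_2^*(\tau)>4$.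
   Context: A radial solution of $(P)_\tau$ with flux pair $(\beta_1,\beta_2)$ is a pair of functions $v_1,v_2\in C([0,\infty))\cap C^2((0,\infty))$ such that, for $r>0$, $$-(rv_1')'=r^{2N+1}e^{v_1}-\tau re^{v_2},\qquad -(rv_2')'=re^{v_2}-\tau r^{2N+1}e^{v_1},$$ $v_1'(0)=v_2'(0)=0$, $$\beta_1=\int_0^\infty r^{2N+1}e^{v_1}\,dr<\infty,\qquad \beta_2=\int_0^\infty re^{v_2}\,dr<\infty,$$ and $\lim_{r\to\infty}rv_1'(r)=-(\beta_1-\tau\beta_2)$, $\lim_{r\to\infty}rv_2'(r)=-(\beta_2-\tau\beta_1)$. (Equivalently, a radially symmetric distributional solution on $\mathbb{R}^2$ of $-\Delta v_1=|x|^{2N}e^{v_1}-\tau e^{v_2}$, $-\Delta v_2=e^{v_2}-\tau|x|^{2N}e^{v_1}$ with $\beta_1=\frac1{2\pi}\int|x|^{2N}e^{v_1}$, $\beta_2=\frac1{2\pi}\int e^{v_2}$ finite.) Notation: $$\beta_1^*(\tau)=4(N+1)+8\tau,\quad \beta_2^*(\tau)=4+8\tau(N+1),\quad \beta_1^{**}(\tau)=8\tau(1+2\tau(N+1)),\quad \beta_2^{**}(\tau)=8\tau(N+1+2\tau).$$ $\tau_1^{(1)}$ is the unique positive zero of $2(1-2\tau^2)(1+2\tau(N+1))-1$; $\tau_1^{(2)}$ is the unique positive zero of $2(1-2\tau^2)(N+1+2\tau)-(N+1)$ (both lie in $(\frac12,\frac1{\sqrt2})$). With $D=(N+1)^2+2\tau(N+1)+1$,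 $$\overline\beta_1=\tfrac{2}{1-\tau^2}(N+1+\tau+\sqrt D),\qquad \overline\beta_2=\tfrac{2}{1-\tau^2}(1+\tau(N+1)+\sqrt D),$$ $$\varphi_1^+(\beta_1)=2+\tau\beta_1+\sqrt{(2+\tau\beta_1)^2-\beta_1(\beta_1-4(N+1))}\ \ (0<\beta_1\le\overline\beta_1),$$ $$\varphi_2^+(\beta_2)=2(N+1)+\tau\beta_2+\sqrt{(2(N+1)+\tau\beta_2)^2-\beta_2(\beta_2-4)}\ \ (0<\beta_2\le\overline\beta_2).$$ *)

(* Defs.v *)
From Stdlib Require Import Reals.
From Coquelicot Require Import Coquelicot.
Open Scope R_scope.

(* r^a for r > 0 (real exponent); set to 0 for r <= 0 (only used at r = 0,
   a single point, irrelevant for integrals and the ODE on r > 0). *)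
Definition rpow (r a : R) : R :=
  if Rle_dec r 0 then 0 else Rpower r a.

Definition C0_C2 (v : R -> R) : Prop :=
  filterlim v (at_right 0) (locally (v 0)) /\
  (forall r, 0 < r -> ex_derive_n v 2 r /\ continuous (Derive_n v 2) r).

Definition right_deriv0_zero (v : R -> R) : Prop :=
  filterlim (fun h => (v h - v 0) / h) (at_right 0) (locally 0).

Definition radial_solution (N tau : R) (v1 v2 : R -> R) (beta1 beta2 : R)
  : Prop :=
  C0_C2 v1 /\ C0_C2 v2 /\
  (forall r, 0 < r ->
     is_derive (fun s => s * Derive v1 s) r
       (- (rpow r (2 * N + 1) * exp (v1 r) - tau * r * exp (v2 r)))) /\
  (forall r, 0 < r ->
     is_derive (fun s => s * Derive v2 s) r
       (- (r * exp (v2 r) - tau * rpow r (2 * N + 1) * exp (v1 r)))) /\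
  right_deriv0_zero v1 /\ right_deriv0_zero v2 /\
  is_RInt_gen (fun r => rpow r (2 * N + 1) * exp (v1 r))
    (at_point 0) (Rbar_locally p_infty) beta1 /\
  is_RInt_gen (fun r => r * exp (v2 r))
    (at_point 0) (Rbar_locally p_infty) beta2 /\
  is_lim (fun r => r * Derive v1 r) p_infty (- (beta1 - tau * beta2)) /\
  is_lim (fun r => r * Derive v2 r) p_infty (- (beta2 - tau * beta1)).

Definition beta1_star (N tau : R) := 4 * (N + 1) + 8 * tau.
Definition beta2_star (N tau : R) := 4 + 8 * tau * (N + 1).
Definition beta1_sstar (N tau : R) := 8 * tau * (1 + 2 * tau * (N + 1)).
Definition beta2_sstar (N tau : R) := 8 * tau * (N + 1 + 2 * tau).

(* polynomials whose unique positive zeros are tau_1^(1), tau_1^(2) *)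
Definition tau11_poly (N t : R) := 2 * (1 - 2 * t ^ 2) * (1 + 2 * t * (N + 1)) - 1.
Definition tau12_poly (N t : R) :=
  2 * (1 - 2 * t ^ 2) * (N + 1 + 2 * t) - (N + 1).

Definition Dd (N tau : R) := (N + 1) ^ 2 + 2 * tau * (N + 1) + 1.
Definition beta1_bar (N tau : R) :=
  2 / (1 - tau ^ 2) * (N + 1 + tau + sqrt (Dd N tau)).
Definition beta2_bar (N tau : R) :=
  2 / (1 - tau ^ 2) * (1 + tau * (N + 1) + sqrt (Dd N tau)).

Definition phi1p (N tau b1 : R) :=
  2 + tau * b1 + sqrt ((2 + tau * b1) ^ 2 - b1 * (b1 - 4 * (N + 1))).
Definition phi2p (N tau b2 : R) :=
  2 * (N + 1) + tau * b2 + sqrt ((2 * (N + 1) + tau * b2) ^ 2 - b2 * (b2 - 4)).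

(* Main.v *)
Require Import Defs.
From Stdlib Require Import Reals Lra Psatz.
From Coquelicot Require Import Coquelicot.
Open Scope R_scope.

(** In the variable [t = ln r], set [M_i(t) = int_(-oo)^t p_i] with
    [p_1 = e^(2 (N + 1) t + v_1)] and [p_2 = e^(2 t + v_2)]. Then
    [p_1' = p_1 (2 a - M_1 + tau M_2)] and [p_2' = p_2 (2 b - M_2 + tau M_1)] with
    [a = N + 1], [b = 1], and [p_1 + p_2] is a quadratic polynomial in [M_1, M_2]. At [+oo] this puts
    [(beta_1, beta_2)] on a conic, on the arc where both coordinates are the larger roots; the point
    [(beta1_star, beta2_sstar)] lies on the same conic. Everything therefore reduces to
    [(1 - 2 tau) (beta_1 - beta1_star) <= 0] and its mirror image.

    For this inequality let [h_1 = M_1^2 / 4 - a M_1 + p_1 / 2], so that [h_1' = tau p_1 M_2 / 2], let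
    [h_2] be its mirror image, and
    [Om = h_1 (M_1 / 2 - beta1_star / 2) + tau p_1 M_2 / 2]. By the quadratic relation
    [Om' = (1 - 2 tau) / 2 * p_1 (tau p_2 - (1 + 2 tau) h_2)], hence
    [Om + (1 - 4 tau^2) / 2 * (M_1 - beta_1) h_2] has derivative
    [(1 - 2 tau) / 2 * tau p_2 (p_1 - (1/2 + tau) M_1 (beta_1 - M_1))]. The last factor is nonpositive,
    being convex as a function of [M_1] and zero at both ends. Since [Om] tends to [0] at [-oo] and to
    [beta_1 (beta_1 - 4 a) (beta_1 - beta1_star) / 8] at [+oo], and [beta_1 > 4 a], the claim follows. *)

(** * Flux orbits *)

Lemma is_lim_mult_finite (f g : R -> R) (x : Rbar) (lf lg : R) :
  is_lim f x lf -> is_lim g x lg -> is_lim (fun t => f t * g t) x (lf * lg).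
Proof. intros Hf Hg. now apply (is_lim_mult f g x lf lg). Qed.

Ltac limit :=
  match goal with
  | H : is_lim ?f ?x _ |- is_lim ?f ?x _ => exact H
  | |- is_lim (fun t => _ + _) _ _ => eapply is_lim_plus'; limit
  | |- is_lim (fun t => _ - _) _ _ => eapply is_lim_minus'; limit
  | |- is_lim (fun t => _ * _) _ _ => eapply is_lim_mult_finite; limit
  | |- is_lim (fun t => ?c) _ _ => apply is_lim_const
  | H : is_lim ?f ?x _ |- is_lim (fun t => ?f t) ?x _ => exact H
  end.

Lemma nondecreasing_of_derive (f df : R -> R) :
  (forall t, is_derive f t (df t)) -> (forall t, 0 <= df t) ->
  forall s t, s <= t -> f s <= f t.
Proof.
  intros Hd Hp s t Hst.
  destruct (MVT_gen f s t df) as [c [_ Hc]].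
  - intros; apply Hd.
  - intros x _. apply continuity_pt_filterlim, (ex_derive_continuous f). now exists (df x).
  - specialize (Hp c). nra.
Qed.

Lemma increasing_of_derive (f df : R -> R) :
  (forall t, is_derive f t (df t)) -> (forall t, 0 < df t) ->
  forall s t, s < t -> f s < f t.
Proof.
  intros Hd Hp s t Hst.
  destruct (MVT_gen f s t df) as [c [_ Hc]].
  - intros; apply Hd.
  - intros x _. apply continuity_pt_filterlim, (ex_derive_continuous f). now exists (df x).
  - specialize (Hp c). nra.
Qed.

Lemma nondecreasing_ge_lim (f : R -> R) (l : R) :
  (forall s t, s <= t -> f s <= f t) -> is_lim f m_infty l -> forall t, l <= f t.
Proof.
  intros Hf Hl t.
  apply (is_lim_le_loc f (fun _ => f t) m_infty l (f t)); trivial.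
  - exists t. intros y Hy. apply Hf; lra.
  - apply is_lim_const.
Qed.

Lemma nondecreasing_le_lim (f : R -> R) (l : R) :
  (forall s t, s <= t -> f s <= f t) -> is_lim f p_infty l -> forall t, f t <= l.
Proof.
  intros Hf Hl t.
  apply (is_lim_le_loc (fun _ => f t) f p_infty (f t) l); trivial.
  - exists t. intros y Hy. apply Hf; lra.
  - apply is_lim_const.
Qed.

Lemma increasing_gt_lim (f : R -> R) (l : R) :
  (forall s t, s < t -> f s < f t) -> is_lim f m_infty l -> forall t, l < f t.
Proof.
  intros Hf Hl t.
  apply Rle_lt_trans with (f (t - 1)).
  - apply nondecreasing_ge_lim; trivial.
    intros s u [H|H]; [left; auto | subst; right; auto].
  - apply Hf; lra.
Qed.

Lemma increasing_lt_lim (f : R -> R) (l : R) :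
  (forall s t, s < t -> f s < f t) -> is_lim f p_infty l -> forall t, f t < l.
Proof.
  intros Hf Hl t.
  apply Rlt_le_trans with (f (t + 1)).
  - apply Hf; lra.
  - apply nondecreasing_le_lim; trivial.
    intros s u [H|H]; [left; auto | subst; right; auto].
Qed.

Lemma zero_of_derive_zero_lim (f : R -> R) (x : Rbar) :
  (forall t, is_derive f t 0) -> is_lim f x 0 -> forall t, f t = 0.
Proof.
  intros Hd Hl t.
  assert (H : forall s, f t = f s).
  { intros s. destruct (MVT_gen f t s (fun _ => 0)) as [c [_ Hc]].
    - intros; apply Hd.
    - intros y _. apply continuity_pt_filterlim, (ex_derive_continuous f). now exists 0.
    - lra. }
  pose proof (is_lim_unique _ _ _ (is_lim_ext _ _ x (f t) H (is_lim_const (f t) x))) as Ht.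
  rewrite (is_lim_unique _ _ _ Hl) in Ht. congruence.
Qed.

(** By the mean value theorem a unit step of [f] far out equals some [df c]. The step is smaller
    than [Rabs l' / 2], whereas [df c] would exceed [3 / 4 * Rabs l'] in size if [l'] were
    nonzero. *)
Lemma derive_lim_zero (f df : R -> R) (l l' : R) :
  (forall t, is_derive f t (df t)) ->
  is_lim f p_infty l -> is_lim df p_infty l' -> l' = 0.
Proof.
  intros Hd Hf Hdf.
  assert (Hc : forall x, continuity_pt f x).
  { intros x. apply continuity_pt_filterlim, (ex_derive_continuous f). now exists (df x). }
  apply is_lim_spec in Hf, Hdf.
  destruct (Req_dec l' 0) as [H|H]; trivial; exfalso.
  pose proof (Rabs_pos_lt _ H) as Hp.
  assert (He : 0 < Rabs l' / 4) by lra.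
  destruct (Hf (mkposreal _ He)) as [A HA], (Hdf (mkposreal _ He)) as [B HB]; simpl in *.
  set (t := Rmax A B + 1).
  pose proof (Rmax_l A B). pose proof (Rmax_r A B).
  destruct (MVT_gen f t (t + 1) df) as [c [Hc1 Hc2]]; auto.
  rewrite Rmin_left, Rmax_right in Hc1 by lra.
  assert (G1 := HA t ltac:(unfold t; lra)). assert (G2 := HA (t + 1) ltac:(unfold t; lra)).
  assert (G3 := HB c ltac:(unfold t in *; lra)).
  revert G1 G2 G3. replace (t + 1 - t) with 1 in Hc2 by ring.
  revert He Hp. unfold Rabs; repeat destruct Rcase_abs; lra.
Qed.

(** The autonomous system in [t = ln r]. With [a] and [b] free, exchanging the two components is a
    symmetry, so each estimate is proved for one component only. *)
Record flux_orbit (a b tau : R) (M1 M2 p1 p2 : R -> R) (beta1 beta2 : R) : Prop := {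
  orbit_a : 0 < a;
  orbit_b : 0 < b;
  orbit_tau : 0 < tau < 1;
  orbit_p1_pos : forall t, 0 < p1 t;
  orbit_p2_pos : forall t, 0 < p2 t;
  orbit_M1 : forall t, is_derive M1 t (p1 t);
  orbit_M2 : forall t, is_derive M2 t (p2 t);
  orbit_p1 : forall t, is_derive p1 t (p1 t * (2 * a - M1 t + tau * M2 t));
  orbit_p2 : forall t, is_derive p2 t (p2 t * (2 * b - M2 t + tau * M1 t));
  orbit_M1_m : is_lim M1 m_infty 0;
  orbit_M2_m : is_lim M2 m_infty 0;
  orbit_p1_m : is_lim p1 m_infty 0;
  orbit_p2_m : is_lim p2 m_infty 0;
  orbit_M1_p : is_lim M1 p_infty beta1;
  orbit_M2_p : is_lim M2 p_infty beta2 }.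

Lemma flux_orbit_swap a b tau M1 M2 p1 p2 beta1 beta2 :
  flux_orbit a b tau M1 M2 p1 p2 beta1 beta2 ->
  flux_orbit b a tau M2 M1 p2 p1 beta2 beta1.
Proof. intros []; constructor; trivial. Qed.

Ltac rewrite_derive D t :=
  match type of (D t) with
  | is_derive ?f _ ?l =>
      rewrite ?(is_derive_unique (fun x : R => f x) t l (D t) : Derive (fun x : R => f x) t = l)
  end.

Ltac derive_orbit D1 D2 E1 E2 t :=
  auto_derive;
  [ repeat split;
    first [ eexists; exact (D1 t) | eexists; exact (D2 t)
          | eexists; exact (E1 t) | eexists; exact (E2 t) ]
  | rewrite_derive D1 t; rewrite_derive D2 t; rewrite_derive E1 t; rewrite_derive E2 t ].

Section Orbit.
Context (a b tau : R) (M1 M2 p1 p2 : R -> R) (beta1 beta2 : R).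
Context (orbit : flux_orbit a b tau M1 M2 p1 p2 beta1 beta2).

(** Both sides vanish at -oo and have the same derivative: the coupling terms add up to
    [tau (p1 M2 + M1 p2)], the derivative of [tau M1 M2]. *)
Lemma orbit_energy t :
  p1 t + p2 t =
  2 * a * M1 t + 2 * b * M2 t
  - / 2 * (M1 t * M1 t - 2 * tau * M1 t * M2 t + M2 t * M2 t).
Proof.
  destruct orbit as [Ha Hb Htau P1 P2 D1 D2 E1 E2 L1 L2 K1 K2 _ _].
  apply Rminus_diag_uniq.
  apply (zero_of_derive_zero_lim (fun t => p1 t + p2 t - (2 * a * M1 t + 2 * b * M2 t
  - / 2 * (M1 t * M1 t - 2 * tau * M1 t * M2 t + M2 t * M2 t))) m_infty); clear t.
  - intros t. derive_orbit D1 D2 E1 E2 t. field.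
  (* The value [l] is left open for [limit] to compute; it is then checked to be 0. *)
  - evar (l : R). replace (Finite 0) with (Finite l).
    + unfold l. limit.
    + unfold l. f_equal. ring.
Qed.

Lemma orbit_M1_pos t : 0 < M1 t.
Proof.
  destruct orbit. apply increasing_gt_lim; trivial.
  now apply increasing_of_derive with p1.
Qed.

Lemma orbit_M1_lt t : M1 t < beta1.
Proof.
  destruct orbit. apply increasing_lt_lim; trivial.
  now apply increasing_of_derive with p1.
Qed.

(** The energy relation gives [p1 + p2] the limit [l] at +oo. As [p1 + p2] is the derivative of the
    convergent function [M1 + M2], [l = 0], which is the conic. *)
Lemma orbit_conic :
  beta1 ^ 2 - 2 * tau * beta1 * beta2 + beta2 ^ 2 = 4 * a * beta1 + 4 * b * beta2
  /\ is_lim (fun t => p1 t + p2 t) p_infty 0.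
Proof.
  destruct orbit as [Ha Hb Htau P1 P2 D1 D2 E1 E2 L1 L2 K1 K2 B1 B2].
  set (l := 2 * a * beta1 + 2 * b * beta2
     - / 2 * (beta1 * beta1 - 2 * tau * beta1 * beta2 + beta2 * beta2)).
  assert (Hl : is_lim (fun t => p1 t + p2 t) p_infty l).
  { apply is_lim_ext with (2 := ltac:(limit) : is_lim (fun t => 2 * a * M1 t + 2 * b * M2 t
  - / 2 * (M1 t * M1 t - 2 * tau * M1 t * M2 t + M2 t * M2 t)) p_infty l).
    intros t. now rewrite orbit_energy. }
  assert (H0 : l = 0).
  { apply (derive_lim_zero (fun t => M1 t + M2 t) (fun t => p1 t + p2 t) (beta1 + beta2) l);
      trivial.
    - intros t. derive_orbit D1 D2 E1 E2 t. ring.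
    - limit. }
  split; [unfold l in *; lra | now rewrite H0 in Hl].
Qed.

Lemma orbit_p1_p : is_lim p1 p_infty 0.
Proof.
  destruct orbit.
  apply (is_lim_le_le_loc (fun _ => 0) (fun t => p1 t + p2 t)).
  - exists 0. intros t _. specialize (orbit_p1_pos0 t). specialize (orbit_p2_pos0 t). lra.
  - apply is_lim_const.
  - apply orbit_conic.
Qed.

(** This selects the larger root when the conic is read as a quadratic in [beta1]. If the growth
    rate of [p1] had a positive limit, [p1] would be nondecreasing from some time on and could not
    tend to 0. *)
Lemma orbit_exit : 2 * a - beta1 + tau * beta2 <= 0.
Proof.
  pose proof orbit_p1_p as Hp.
  destruct orbit as [Ha Hb Htau P1 P2 D1 D2 E1 E2 L1 L2 K1 K2 B1 B2].
  apply Rnot_lt_le. intros H.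
  assert (Hx : is_lim (fun t => 2 * a - M1 t + tau * M2 t) p_infty (2 * a - beta1 + tau * beta2))
    by limit.
  apply is_lim_spec in Hx, Hp.
  destruct (Hx (mkposreal _ H)) as [T HT]; simpl in HT.
  destruct (Hp (mkposreal _ (P1 (T + 1)))) as [T' HT']; simpl in HT'.
  pose proof (Rmax_l (T + 1) T'). pose proof (Rmax_r (T + 1) T').
  set (u := Rmax (T + 1) T' + 1) in *.
  destruct (MVT_gen p1 (T + 1) u (fun t => p1 t * (2 * a - M1 t + tau * M2 t))) as [c [Hc1 Hc2]].
  - intros; apply E1.
  - intros x _. apply continuity_pt_filterlim, (ex_derive_continuous p1). now eexists.
  - rewrite Rmin_left, Rmax_right in Hc1 by (unfold u; lra).
    specialize (HT c ltac:(lra)). specialize (HT' u ltac:(unfold u; lra)).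
    apply Rabs_def2 in HT, HT'. specialize (P1 c).
    assert (0 <= p1 c * (2 * a - M1 c + tau * M2 c)) by (apply Rmult_le_pos; lra).
    assert (0 <= u - (T + 1)) by (unfold u; lra).
    nra.
Qed.

(* As a function of [M1], the difference [(1/2 + tau) M1 (beta1 - M1) - p1] is concave and vanishes at both ends. *)
Lemma orbit_p1_le t : p1 t <= (/ 2 + tau) * (M1 t * (beta1 - M1 t)).
Proof.
  pose proof orbit_p1_p as Hp.
  pose proof (fun s u => increasing_of_derive M1 p1 (orbit_M1 _ _ _ _ _ _ _ _ _ orbit)
     (orbit_p1_pos _ _ _ _ _ _ _ _ _ orbit) s u) as I1.
  pose proof (fun s u => increasing_of_derive M2 p2 (orbit_M2 _ _ _ _ _ _ _ _ _ orbit)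
     (orbit_p2_pos _ _ _ _ _ _ _ _ _ orbit) s u) as I2.
  destruct orbit as [Ha Hb Htau P1 P2 D1 D2 E1 E2 L1 L2 K1 K2 B1 B2].
  set (psi := fun t => (/ 2 + tau) * (M1 t * (beta1 - M1 t)) - p1 t).
  (* The derivative of [psi] with respect to [M1]; it decreases because [M1] and [M2] increase. *)
  set (d := fun t => (/ 2 + tau) * beta1 - 2 * a - 2 * tau * M1 t - tau * M2 t).
  assert (Hd : forall s, is_derive psi s (p1 s * d s)).
  { intros s. unfold psi, d. derive_orbit D1 D2 E1 E2 s. field. }
  assert (Hc : forall s, continuity_pt psi s).
  { intros x. apply continuity_pt_filterlim, (ex_derive_continuous psi). now eexists. }
  assert (Hdec : forall s u, s <= u -> d u <= d s).
  { intros s u [H|H]; [|subst; lra]. specialize (I1 s u H). specialize (I2 s u H).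
    unfold d. nra. }
  assert (Hm : is_lim psi m_infty 0).
  { replace 0 with ((/ 2 + tau) * (0 * (beta1 - 0)) - 0) by ring. unfold psi. limit. }
  assert (HP : is_lim psi p_infty 0).
  { replace 0 with ((/ 2 + tau) * (beta1 * (beta1 - beta1)) - 0) by ring. unfold psi. limit. }
  enough (0 <= psi t) by (unfold psi in *; lra).
  (* If [0 <= d t], then [psi] is nondecreasing up to [t] and is compared with its limit at -oo;
     otherwise it is nonincreasing from [t] on and is compared with its limit at +oo. *)
  destruct (Rle_dec 0 (d t)) as [H|H].
  - apply (is_lim_le_loc psi (fun _ => psi t) m_infty 0 (psi t)); trivial.
    + exists t. intros y Hy.
      destruct (MVT_gen psi y t (fun s => p1 s * d s)) as [c [Hc1 Hc2]]; auto.
      rewrite Rmin_left, Rmax_right in Hc1 by lra.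
      specialize (Hdec c t ltac:(lra)). specialize (P1 c).
      assert (0 <= p1 c * d c) by (apply Rmult_le_pos; lra). nra.
    + apply is_lim_const.
  - apply (is_lim_le_loc psi (fun _ => psi t) p_infty 0 (psi t)); trivial.
    + exists t. intros y Hy.
      destruct (MVT_gen psi t y (fun s => p1 s * d s)) as [c [Hc1 Hc2]]; auto.
      rewrite Rmin_left, Rmax_right in Hc1 by lra.
      specialize (Hdec t c ltac:(lra)). specialize (P1 c).
      assert (p1 c * d c <= 0) by nra. nra.
    + apply is_lim_const.
Qed.

End Orbit.

(** The function [h] increases strictly from 0 at -oo to [beta1 (beta1 - 4 a) / 4] at +oo, and
    [beta1] is positive. *)
Lemma orbit_beta1_gt a b tau M1 M2 p1 p2 beta1 beta2 :
  flux_orbit a b tau M1 M2 p1 p2 beta1 beta2 -> 4 * a < beta1.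
Proof.
  intros orbit.
  pose proof (orbit_p1_p _ _ _ _ _ _ _ _ _ orbit) as Hp.
  pose proof (orbit_M1_pos _ _ _ _ _ _ _ _ _ orbit 0) as Q1.
  pose proof (orbit_M1_lt _ _ _ _ _ _ _ _ _ orbit 0) as Q2.
  pose proof (orbit_M1_pos _ _ _ _ _ _ _ _ _ (flux_orbit_swap _ _ _ _ _ _ _ _ _ orbit)) as Q.
  destruct orbit as [Ha Hb Htau P1 P2 D1 D2 E1 E2 L1 L2 K1 K2 B1 B2].
  set (h := fun t => / 4 * (M1 t * M1 t) - a * M1 t + / 2 * p1 t).
  assert (Hi : forall s t, s < t -> h s < h t).
  { apply increasing_of_derive with (fun t => / 2 * tau * (p1 t * M2 t)).
    - intros t. unfold h. derive_orbit D1 D2 E1 E2 t. field.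
    - intros t. apply Rmult_lt_0_compat; [lra|]. now apply Rmult_lt_0_compat. }
  assert (H0 : 0 < h 0).
  { apply increasing_gt_lim; trivial.
    replace 0 with (/ 4 * (0 * 0) - a * 0 + / 2 * 0) by ring. unfold h. limit. }
  assert (H1 : h 0 < / 4 * (beta1 * beta1) - a * beta1 + / 2 * 0).
  { apply increasing_lt_lim; trivial. unfold h. limit. }
  nra.
Qed.

(* [Om] comes from [f = exp (int M1 / 2)], for which [f'' - 2 a f' = f h1] and
   [(d/dt - (2 a + 4 tau b)) (f h1) = f Om]; for [tau = 1/2] this is the third-order linear equation
   of the Toda system, and [Om] vanishes identically. *)
Lemma orbit_beta1_star a b tau M1 M2 p1 p2 beta1 beta2 :
  flux_orbit a b tau M1 M2 p1 p2 beta1 beta2 ->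
  0 <= (1 - 2 * tau) * (4 * a + 8 * tau * b - beta1).
Proof.
  intros orbit.
  pose proof (orbit_beta1_gt _ _ _ _ _ _ _ _ _ orbit) as Hgt.
  pose proof (orbit_p1_p _ _ _ _ _ _ _ _ _ orbit) as Hp1.
  pose proof (orbit_p1_p _ _ _ _ _ _ _ _ _ (flux_orbit_swap _ _ _ _ _ _ _ _ _ orbit)) as Hp2.
  pose proof (orbit_p1_le _ _ _ _ _ _ _ _ _ orbit) as Hle.
  pose proof (orbit_energy _ _ _ _ _ _ _ _ _ orbit) as Hen.
  destruct orbit as [Ha Hb Htau P1 P2 D1 D2 E1 E2 L1 L2 K1 K2 B1 B2].
  set (h1 := fun t => / 4 * (M1 t * M1 t) - a * M1 t + / 2 * p1 t).
  set (h2 := fun t => / 4 * (M2 t * M2 t) - b * M2 t + / 2 * p2 t).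
  set (Om := fun t => h1 t * (/ 2 * M1 t - (2 * a + 4 * tau * b)) + / 2 * tau * (p1 t * M2 t)).
  (* The factor [- (1 - 2 tau)] completes the [1 - 2 tau] in the derivative to a square, so that [Z]
     is nondecreasing on either side of [tau = 1/2]. *)
  set (Z := fun t => - (1 - 2 * tau) * (Om t + (/ 2 * (1 - 4 * tau ^ 2)) * ((M1 t - beta1) * h2 t))).
  assert (Hd : forall t, is_derive Z t
    (/ 2 * (1 - 2 * tau) ^ 2 * tau * (p2 t * ((/ 2 + tau) * (M1 t * (beta1 - M1 t)) - p1 t)))).
  { intros t. unfold Z, Om, h1, h2. derive_orbit D1 D2 E1 E2 t.
    pose proof (Hen t) as He.
    (* Once the energy relation has eliminated [p2], the claim is a polynomial identity. *)
    replace (p2 t) with (2 * a * M1 t + 2 * b * M2 t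
      - / 2 * (M1 t * M1 t - 2 * tau * M1 t * M2 t + M2 t * M2 t) - p1 t) by lra.
    field. }
  assert (Hi : forall s t, s <= t -> Z s <= Z t).
  { apply (nondecreasing_of_derive Z) with (1 := Hd). intros t.
    apply Rmult_le_pos.
    - apply Rmult_le_pos; [|lra]. pose proof (pow2_ge_0 (1 - 2 * tau)). lra.
    - specialize (Hle t). specialize (P2 t). apply Rmult_le_pos; lra. }
  assert (HZ : 0 <= Z 0).
  { apply nondecreasing_ge_lim; trivial.
    evar (l : R). replace (Finite 0) with (Finite l).
    - unfold l, Z, Om, h1, h2. limit.
    - unfold l. f_equal. field. }
  assert (HZ' : Z 0 <= - (1 - 2 * tau) * (/ 4 * beta1 * (beta1 - 4 * a) * / 2 * (beta1 - (4 * a + 8 * tau * b)))).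
  { apply nondecreasing_le_lim; trivial.
    evar (l : R). match goal with |- is_lim _ _ ?x => replace x with (Finite l) end.
    - unfold l, Z, Om, h1, h2. limit.
    - unfold l. f_equal. field. }
  assert (0 < beta1 * (beta1 - 4 * a)) by (apply Rmult_lt_0_compat; lra).
  apply Rnot_lt_le. intros Hn.
  assert (0 <= (beta1 * (beta1 - 4 * a)) * ((1 - 2 * tau) * (4 * a + 8 * tau * b - beta1))) by lra.
  nra.
Qed.

(** * Differentiability of solutions *)

(** A mean value inequality from arbitrarily short right increments, without differentiability. The
    supremum of the points up to which the bound holds satisfies it by continuity; if it lay before
    [q], a short increment there would carry the bound further. *)
Lemma increment_ge_of_frequent_slopes (v : R -> R) (m p q : R) :
  p <= q ->
  (forall x, p <= x <= q -> continuous v x) ->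
  (forall x eta, p <= x < q -> 0 < eta ->
     exists h, 0 < h < eta /\ m * h <= v (x + h) - v x) ->
  m * (q - p) <= v q - v p.
Proof.
  intros Hpq Hc Hs.
  set (E := fun x => p <= x <= q /\ m * (x - p) <= v x - v p).
  destruct (completeness E) as [s [Hub Hlub]].
  - exists q. intros x [Hx _]; lra.
  - exists p. split; lra.
  - assert (Hsp : p <= s) by (apply Hub; split; lra).
    assert (Hsq : s <= q) by (apply Hlub; intros x [Hx _]; lra).
    assert (HE : E s).
    { split; [lra|]. apply Rnot_lt_le. intros Hn.
      assert (Hg : continuous (fun x => v x - v p - m * (x - p)) s).
      { apply (continuous_minus (fun x => v x - v p) (fun x => m * (x - p))).
        - apply (continuous_minus v (fun _ => v p)); [apply Hc; lra | apply continuous_const].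
        - apply (ex_derive_continuous (fun x => m * (x - p))). auto_derive; trivial. }
      assert (He : 0 < - (v s - v p - m * (s - p))) by lra.
      apply filterlim_locally with (eps := mkposreal _ He) in Hg.
      destruct Hg as [d Hd].
      destruct (Hlub (s - d)) as [].
      - intros x [Hx Hx']. apply Rnot_lt_le. intros Hxd.
        assert (Hxs : x <= s) by (apply Hub; split; lra).
        assert (B : ball s d x).
        { change (Rabs (x - s) < d). rewrite Rabs_left1; lra. }
        specialize (Hd x B).
        change (Rabs ((v x - v p - m * (x - p)) - (v s - v p - m * (s - p)))
          < - (v s - v p - m * (s - p))) in Hd.
        apply Rabs_def2 in Hd. lra.
      - pose proof (cond_pos d). lra.
      - pose proof (cond_pos d). lra. }
    destruct (Rle_lt_or_eq_dec s q Hsq) as [Hlt|Heq].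
    + destruct (Hs s (q - s)) as [h [Hh1 Hh2]]; [lra|lra|].
      assert (s + h <= s); [|lra].
      apply Hub. destruct HE. split; [lra|].
      replace (m * (s + h - p)) with (m * (s - p) + m * h) by ring. lra.
    + subst. apply HE.
Qed.

(** A nonzero [Derive v x] forces the upper limit of the quotients along [1/(n+1)] to be finite, and
    it is at least the mean of the upper and lower limits. Quotients come close to the upper limit
    for arbitrarily large [n]. *)
Lemma frequent_slope_ge_Derive (v : R -> R) (x eps eta : R) :
  Derive v x <> 0 -> 0 < eps -> 0 < eta ->
  exists h, 0 < h < eta /\ (Derive v x - eps) * h <= v (x + h) - v x.
Proof.
  intros Hw He Heta.
  set (u := fun n => (v (x + Rbar_loc_seq 0 n) - v x) / Rbar_loc_seq 0 n).
  assert (Hu : Derive v x = real (Lim_seq u)) by reflexivity.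
  assert (Hsup : exists ls : R, is_LimSup_seq u ls /\ Derive v x <= ls).
  { revert Hu. unfold Lim_seq.
    pose proof (LimSup_LimInf_seq_le u) as Hle. revert Hle.
    unfold LimSup_seq. destruct (ex_LimSup_seq u) as [ls Hls]. simpl.
    destruct ls as [ls| |], (LimInf_seq u) as [li| |]; simpl; intros Hle Hu;
      try contradiction; try (exfalso; apply Hw; rewrite Hu; try reflexivity; unfold Rdiv; ring).
    exists ls; split; trivial. lra. }
  destruct Hsup as [ls [Hls Hle]].
  destruct (nfloor_ex (/ eta)) as [k Hk]; [left; now apply Rinv_0_lt_compat|].
  destruct (proj1 (Hls (mkposreal _ He)) k) as [n [Hn1 Hn2]]; simpl in Hn2.
  assert (HN : 0 < INR n + 1) by (pose proof (pos_INR n); lra).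
  exists (/ (INR n + 1)).
  assert (Hp : 0 < / (INR n + 1)) by now apply Rinv_0_lt_compat.
  split; [split; trivial|].
  - rewrite <- (Rinv_inv eta). apply Rinv_0_lt_contravar; [now apply Rinv_0_lt_compat|].
    apply le_INR in Hn1. lra.
  - unfold u in Hn2. simpl in Hn2. rewrite Rplus_0_l in Hn2.
    apply Rle_trans with ((ls - eps) * / (INR n + 1)).
    + apply Rmult_le_compat_r; lra.
    + apply Rlt_le, (Rmult_le_compat_r _ _ _ (Rlt_le _ _ Hp)) in Hn2.
      replace (v (x + / (INR n + 1)) - v x) with
        ((v (x + / (INR n + 1)) - v x) / / (INR n + 1) * / (INR n + 1)) by (field; lra).
      exact Hn2.
Qed.

Lemma is_derive_of_slopes (v : R -> R) (x l : R) :
  (forall eps, 0 < eps -> exists d, 0 < d /\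
     forall p q, p < q -> Rabs (p - x) < d -> Rabs (q - x) < d -> p = x \/ q = x ->
       (l - eps) * (q - p) <= v q - v p <= (l + eps) * (q - p)) ->
  is_derive v x l.
Proof.
  intros H. apply is_derive_Reals. intros eps He.
  destruct (H (eps / 2)) as [d [Hd HH]]; [lra|].
  exists (mkposreal d Hd). intros h Hh0 Hh; simpl in Hh.
  set (Q := (v (x + h) - v x) / h).
  assert (HQ : v (x + h) - v x = Q * h) by (unfold Q; now field).
  apply Rabs_def2 in Hh.
  enough (l - eps / 2 <= Q <= l + eps / 2) by (apply Rabs_def1; lra).
  destruct (Rlt_le_dec 0 h) as [Hp|Hn].
  - destruct (HH x (x + h)) as [G1 G2]; auto; try lra.
    + rewrite Rminus_diag, Rabs_R0; lra.
    + apply Rabs_def1; lra.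
    + rewrite HQ in G1, G2. split; apply Rmult_le_reg_r with h; lra.
  - destruct (HH (x + h) x) as [G1 G2]; auto; try lra.
    + apply Rabs_def1; lra.
    + rewrite Rminus_diag, Rabs_R0; lra.
    + split; apply Rmult_le_reg_r with (- h); lra.
Qed.

Lemma locally_Rabs_lt (P : R -> Prop) (x : R) :
  locally x P -> exists d, 0 < d /\ forall y, Rabs (y - x) < d -> P y.
Proof. intros [d Hd]. exists d. split; [apply cond_pos | exact Hd]. Qed.

Lemma continuous_Rabs_lt (f : R -> R) (x eps : R) :
  continuous f x -> 0 < eps -> locally x (fun y => Rabs (f y - f x) < eps).
Proof. intros Hf He. exact (proj1 (filterlim_locally _ _) Hf (mkposreal _ He)). Qed.

(* [Derive] is the mean of the upper and lower limits of the difference quotient along the single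
   sequence [1/(n+1)], and is [0] if that mean is infinite or undefined; it says nothing about
   [ex_derive] by itself. *)
Lemma is_derive_of_Derive_neq_0 (v : R -> R) (x : R) :
  locally x (continuous v) -> continuous (Derive v) x -> Derive v x <> 0 ->
  is_derive v x (Derive v x).
Proof.
  intros Hv Hd Hw. apply is_derive_of_slopes. intros eps He.
  (* The second bound keeps [Derive v] nonzero near [x], as needed to find frequent slopes at the
     neighbouring points. *)
  assert (He2 : 0 < Rmin (eps / 2) (Rabs (Derive v x))).
  { apply Rmin_pos; [lra | now apply Rabs_pos_lt]. }
  destruct (locally_Rabs_lt _ _ (filter_and _ _ Hv (continuous_Rabs_lt _ _ _ Hd He2))) as [d [Hd0 HH]].
  exists d; split; trivial. intros p q Hpq Hp Hq _.
  apply Rabs_def2 in Hp, Hq.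
  assert (Hy : forall y, p <= y <= q -> continuous v y /\ Derive v y <> 0 /\
     Derive v x - eps / 2 <= Derive v y <= Derive v x + eps / 2).
  { intros y Hy. destruct (HH y) as [G1 G2]; [apply Rabs_def1; lra|].
    split; trivial.
    pose proof (Rmin_l (eps / 2) (Rabs (Derive v x))).
    pose proof (Rmin_r (eps / 2) (Rabs (Derive v x))).
    split.
    - intros Hz. rewrite Hz in G2. rewrite Rabs_minus_sym, Rminus_0_r in G2. lra.
    - assert (G3 : Rabs (Derive v y - Derive v x) < eps / 2) by lra.
      apply Rabs_def2 in G3. lra. }
  split.
  - apply increment_ge_of_frequent_slopes; [lra | apply Hy |].
    intros y eta Hyq Heta. destruct (Hy y) as [_ [G1 G2]]; [lra|].
    destruct (frequent_slope_ge_Derive v y (eps / 2) eta) as [h [Hh1 Hh2]]; trivial; [lra|].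
    exists h; split; trivial. apply Rle_trans with (2 := Hh2). apply Rmult_le_compat_r; lra.
  (* The upper bound is the lower bound for [- v]. *)
  - enough ((- (Derive v x + eps)) * (q - p) <= (fun z => - v z) q - (fun z => - v z) p) by (simpl in *; lra).
    apply (increment_ge_of_frequent_slopes (fun z => - v z)); [lra | |].
    + intros y Hpy. apply (continuous_opp v). now apply Hy.
    + intros y eta Hyq Heta. destruct (Hy y) as [_ [G1 G2]]; [lra|].
      pose proof (Derive_opp v y) as Ho.
      destruct (frequent_slope_ge_Derive (fun z => - v z) y (eps / 2) eta) as [h [Hh1 Hh2]];
        trivial; [rewrite Ho; lra | lra |].
      exists h; split; trivial. apply Rle_trans with (2 := Hh2). rewrite Ho.
      apply Rmult_le_compat_r; lra.
Qed.

(** This fills in isolated points: the slope from [x] to a nearby point is [w c] with [c] in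
    between, and [w] is continuous at [x]. *)
Lemma is_derive_of_punctured (v w : R -> R) (x : R) :
  locally x (continuous v) -> continuous w x ->
  (exists d, 0 < d /\ forall y, 0 < Rabs (y - x) < d -> is_derive v y (w y)) ->
  is_derive v x (w x).
Proof.
  intros Hv Hw [d1 [Hd1 HD]]. apply is_derive_of_slopes. intros eps He.
  destruct (locally_Rabs_lt _ _ (filter_and _ _ Hv (continuous_Rabs_lt _ _ _ Hw He))) as [d2 [Hd2 HH]].
  exists (Rmin d1 d2); split; [now apply Rmin_pos|].
  pose proof (Rmin_l d1 d2). pose proof (Rmin_r d1 d2).
  intros p q Hpq Hp Hq Hx.
  assert (Hp1 : Rabs (p - x) < d1) by lra. assert (Hp2 : Rabs (p - x) < d2) by lra.
  assert (Hq1 : Rabs (q - x) < d1) by lra. assert (Hq2 : Rabs (q - x) < d2) by lra.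
  apply Rabs_def2 in Hp1, Hp2, Hq1, Hq2.
  assert (Hslope : exists c, p <= c <= q /\ v q - v p = w c * (q - p)).
  { destruct (MVT_gen v p q w) as [c Hc].
    - rewrite Rmin_left, Rmax_right by lra. intros y Hy. apply HD. split.
      + apply Rabs_pos_lt. destruct Hx; lra.
      + apply Rabs_def1; lra.
    - rewrite Rmin_left, Rmax_right by lra. intros y Hy.
      apply continuity_pt_filterlim, HH, Rabs_def1; lra.
    - rewrite Rmin_left, Rmax_right in Hc by lra. now exists c. }
  destruct Hslope as [c [Hc1 Hc2]]. rewrite Hc2.
  destruct (HH c) as [_ G]; [apply Rabs_def1; lra|]. apply Rabs_def2 in G.
  split; apply Rmult_le_compat_r; lra.
Qed.

Lemma punctured_neq_0_of_derive_neq_0 (g : R -> R) (x l : R) :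
  is_derive g x l -> l <> 0 ->
  exists d, 0 < d /\ forall y, 0 < Rabs (y - x) < d -> g y <> 0.
Proof.
  intros Hg Hl. destruct (Req_dec (g x) 0) as [H0|H0].
  - apply is_derive_Reals in Hg.
    destruct (Hg (Rabs l) (Rabs_pos_lt _ Hl)) as [d Hd].
    exists d. split; [apply cond_pos|]. intros y [Hy1 Hy2] Hy.
    assert (y - x <> 0) by (intros E; rewrite E, Rabs_R0 in Hy1; lra).
    specialize (Hd (y - x) H Hy2). replace (x + (y - x)) with y in Hd by ring.
    rewrite Hy, H0 in Hd. replace ((0 - 0) / (y - x) - l) with (- l) in Hd by now field.
    rewrite Rabs_Ropp in Hd. lra.
  - assert (Hc : continuous g x) by (apply (ex_derive_continuous g); now exists l).
    destruct (locally_Rabs_lt _ _ (continuous_Rabs_lt _ _ _ Hc (Rabs_pos_lt _ H0))) as [d [Hd HH]].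
    exists d; split; trivial. intros y [_ Hy] E. specialize (HH y Hy).
    rewrite E, Rabs_minus_sym, Rminus_0_r in HH. lra.
Qed.

Lemma derive_max_eq_0 (f : R -> R) (p q c l : R) :
  p < c < q -> is_derive f c l -> (forall x, p < x < q -> f x <= f c) -> l = 0.
Proof.
  intros Hc Hd Hm. apply is_derive_Reals in Hd.
  set (pr := exist _ l Hd : derivable_pt f c).
  change l with (derive_pt f c pr). apply (deriv_maximum f p q c pr); try apply Hc; auto.
Qed.

(** A positive maximum would be attained in the interior, at a critical point. *)
Lemma le_0_of_critical_le_0 (f : R -> R) (p q : R) :
  p < q -> f p = 0 -> f q = 0 ->
  (forall x, p <= x <= q -> continuous f x) ->
  (forall x, p < x < q -> f x <> 0 -> exists l, is_derive f x l /\ l <> 0) ->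
  forall x, p <= x <= q -> f x <= 0.
Proof.
  intros Hpq Hp Hq Hc Hd x Hx.
  destruct (continuity_ab_maj f p q) as [z [Hz1 Hz2]]; [lra| |].
  - intros y Hy. now apply continuity_pt_filterlim, Hc.
  - apply Rle_trans with (f z); [now apply Hz1|].
    apply Rnot_lt_le. intros Hn.
    assert (Hz : p < z < q).
    { split; apply Rnot_le_lt; intros H.
      - replace z with p in Hn by lra. lra.
      - replace z with q in Hn by lra. lra. }
    destruct (Hd z Hz) as [l [Hl Hl0]]; [lra|].
    apply Hl0, (derive_max_eq_0 f p q z l); trivial.
    intros y Hy. apply Hz1; lra.
Qed.

Lemma eq_0_of_no_critical (f : R -> R) (p q : R) :
  p < q -> f p = 0 -> f q = 0 ->
  (forall x, p <= x <= q -> continuous f x) ->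
  (forall x, p < x < q -> f x <> 0 -> exists l, is_derive f x l /\ l <> 0) ->
  forall x, p <= x <= q -> f x = 0.
Proof.
  intros Hpq Hp Hq Hc Hd x Hx. apply Rle_antisym.
  - now apply (le_0_of_critical_le_0 f p q).
  - enough ((fun y => - f y) x <= 0) by (simpl in *; lra).
    apply (le_0_of_critical_le_0 (fun y => - f y) p q); trivial; try lra.
    + intros y Hy. now apply (continuous_opp f), Hc.
    + intros y Hy Hfy. destruct (Hd y Hy) as [l [Hl Hl0]]; [lra|].
      exists (- l); split; [|lra]. now apply (is_derive_opp f).
Qed.

Definition density (c : R) (v : R -> R) (r : R) : R := exp (c * ln r + v r).

(** What is available before [v1] and [v2] are known to be differentiable: [ex_derive_n v 2] only
    asserts differentiability of the total function [Derive v], not of [v]. *)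
Record weak_system (c1 c2 tau : R) (v1 v2 : R -> R) : Prop := {
  weak_tau : 0 < tau < 1;
  weak_v1 : forall r, 0 < r -> continuous v1 r;
  weak_v2 : forall r, 0 < r -> continuous v2 r;
  weak_Dv1 : forall r, 0 < r -> continuous (Derive v1) r;
  weak_Dv2 : forall r, 0 < r -> continuous (Derive v2) r;
  weak_eq1 : forall r, 0 < r -> is_derive (fun s => s * Derive v1 s) r
    (- (density c1 v1 r - tau * density c2 v2 r));
  weak_eq2 : forall r, 0 < r -> is_derive (fun s => s * Derive v2 s) r
    (- (density c2 v2 r - tau * density c1 v1 r));
  weak_nondeg : forall r, 0 < r -> Derive v1 r <> 0 \/ Derive v2 r <> 0 }.

Lemma locally_pos (r : R) : 0 < r -> locally r (fun s => 0 < s).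
Proof. apply open_gt. Qed.

(* Only a point where [Derive v1] and the right-hand side of its equation both vanish is a problem.
   There [v1 - v2 + (c1 - c2) ln r = ln tau], and [G], which is [r] times the derivative of the
   left-hand side wherever [v1] is differentiable, has no other zero nearby. So if there were a second
   such point nearby, this function would be constant in between, which contradicts [G <> 0]. *)
Lemma weak_system_is_derive c1 c2 tau v1 v2 (r0 : R) :
  weak_system c1 c2 tau v1 v2 -> 0 < r0 -> is_derive v1 r0 (Derive v1 r0).
Proof.
  intros [Htau C1 C2 DC1 DC2 E1 E2 Hnd] Hr0.
  assert (L1 : forall r, 0 < r -> locally r (continuous v1)).
  { intros r Hr. exact (filter_imp _ _ C1 (locally_pos r Hr)). }
  assert (L2 : forall r, 0 < r -> locally r (continuous v2)).
  { intros r Hr. exact (filter_imp _ _ C2 (locally_pos r Hr)). }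
  destruct (Req_dec (Derive v1 r0) 0) as [Hz|Hz];
    [|apply is_derive_of_Derive_neq_0; auto].
  assert (Hz2 : Derive v2 r0 <> 0) by (destruct (Hnd r0 Hr0); auto; contradiction).
  destruct (locally_Rabs_lt _ _ (filter_and _ _ (locally_pos r0 Hr0)
    (continuous_Rabs_lt _ _ _ (DC2 r0 Hr0) (Rabs_pos_lt _ Hz2)))) as [d0 [Hd0 H0]].
  assert (Hpos : forall r, Rabs (r - r0) < d0 -> 0 < r) by (intros; now apply H0).
  assert (Hv2 : forall r, Rabs (r - r0) < d0 -> is_derive v2 r (Derive v2 r)).
  { intros r Hr. destruct (H0 r Hr) as [Hr1 Hr2].
    apply is_derive_of_Derive_neq_0; auto.
    intros E. rewrite E, Rabs_minus_sym, Rminus_0_r in Hr2. lra. }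
  set (y := fun r => v1 r - v2 r + (c1 - c2) * ln r - ln tau).
  set (G := fun r => r * Derive v1 r - r * Derive v2 r + (c1 - c2)).
  (* Hence [y r = 0] exactly when the right-hand side of the first equation vanishes. *)
  assert (Hf : forall r, density c1 v1 r = tau * density c2 v2 r * exp (y r)).
  { intros r. unfold density, y. rewrite <- (exp_ln tau) at 1 by lra.
    rewrite <- !exp_plus. f_equal. ring. }
  (* If [Derive v1 r = 0] but [y r] is nonzero, then [s * Derive v1 s] has nonzero derivative at
     [r], so this zero is isolated and [v1] is differentiable at all other points nearby. *)
  assert (Hgood : forall r, Rabs (r - r0) < d0 -> Derive v1 r <> 0 \/ y r <> 0 ->
            is_derive v1 r (Derive v1 r)).
  { intros r Hr Hor. pose proof (Hpos r Hr) as Hr'.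
    destruct (Req_dec (Derive v1 r) 0) as [Hd|Hd];
      [|apply is_derive_of_Derive_neq_0; auto].
    destruct Hor as [|Hy]; [contradiction|].
    apply is_derive_of_punctured; auto.
    destruct (punctured_neq_0_of_derive_neq_0 _ _ _ (E1 r Hr')) as [d [Hd0' HH]].
    - rewrite Hf. intros Hk.
      assert (0 < tau * density c2 v2 r) by (apply Rmult_lt_0_compat; [lra | apply exp_pos]).
      assert (exp (y r) = 1) by nra.
      apply Hy. rewrite <- (ln_exp (y r)), H1. apply ln_1.
    - exists (Rmin d r); split; [now apply Rmin_pos|].
      intros s [Hs1 Hs2]. pose proof (Rmin_l d r). pose proof (Rmin_r d r).
      assert (Hsr : Rabs (s - r) < r) by lra. apply Rabs_def2 in Hsr.
      apply is_derive_of_Derive_neq_0; [apply L1; lra | apply DC1; lra |].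
      intros E. apply (HH s); [lra|]. rewrite E. ring. }
  destruct (Req_dec (y r0) 0) as [Hy0|Hy0].
  2: { apply Hgood; auto. rewrite Rminus_diag, Rabs_R0; lra. }
  assert (HG : is_derive G r0 ((1 + tau) * (density c2 v2 r0 - density c1 v1 r0))).
  { replace ((1 + tau) * (density c2 v2 r0 - density c1 v1 r0)) with
      (- (density c1 v1 r0 - tau * density c2 v2 r0)
       - - (density c2 v2 r0 - tau * density c1 v1 r0) + 0) by ring.
    apply (is_derive_plus (fun r => r * Derive v1 r - r * Derive v2 r) (fun _ => c1 - c2)).
    - apply (is_derive_minus (fun r => r * Derive v1 r) (fun r => r * Derive v2 r)); auto.
    - apply (is_derive_const (c1 - c2)). }
  destruct (punctured_neq_0_of_derive_neq_0 _ _ _ HG) as [d1 [Hd1 HG1]].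
  (* As [y r0 = 0], the derivative of [G] at [r0] is [(1 + tau) (1 - tau)] times the second
     density. *)
  { rewrite Hf, Hy0, exp_0. pose proof (exp_pos (c2 * ln r0 + v2 r0)). unfold density.
    assert (0 < (1 - tau) * exp (c2 * ln r0 + v2 r0)) by (apply Rmult_lt_0_compat; lra).
    nra. }
  assert (Hcy : forall r, 0 < r -> continuous y r).
  { intros r Hr. apply (continuous_minus (fun r => v1 r - v2 r + (c1 - c2) * ln r)).
    - apply (continuous_plus (fun r => v1 r - v2 r)).
      + apply (continuous_minus v1 v2); auto.
      + apply (ex_derive_continuous (fun r => (c1 - c2) * ln r)). auto_derive; trivial.
    - apply continuous_const. }
  apply is_derive_of_punctured; auto.
  exists (Rmin d0 d1); split; [now apply Rmin_pos|].
  pose proof (Rmin_l d0 d1). pose proof (Rmin_r d0 d1).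
  intros q [Hq1 Hq2]. apply Hgood; [lra|].
  destruct (Req_dec (Derive v1 q) 0) as [Hq3|]; [right|now left].
  intros Hyq.
  set (p := Rmin r0 q). set (p' := Rmax r0 q).
  assert (Hpp : p < p' /\ y p = 0 /\ y p' = 0 /\
    forall r, (p <= r <= p' -> Rabs (r - r0) < Rmin d0 d1) /\ (p < r < p' -> 0 < Rabs (r - r0))).
  { assert (q <> r0) by (intros E; rewrite E, Rminus_diag, Rabs_R0 in Hq1; lra).
    apply Rabs_def2 in Hq2. unfold p, p'.
    destruct (Rle_dec r0 q).
    - rewrite Rmin_left, Rmax_right by lra. repeat split; try lra.
      + intros Hr. apply Rabs_def1; lra.
      + intros Hr. apply Rabs_pos_lt; lra.
    - rewrite Rmin_right, Rmax_left by lra. repeat split; try lra.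
      + intros Hr. apply Rabs_def1; lra.
      + intros Hr. apply Rabs_pos_lt; lra. }
  destruct Hpp as [Hpp [Hyp [Hyp' Hin]]].
  assert (Hdy : forall r l, 0 < r -> Rabs (r - r0) < d0 -> is_derive v1 r l ->
     is_derive y r (l - Derive v2 r + (c1 - c2) / r)).
  { intros r l Hr Hr' Hl. specialize (Hv2 r Hr'). unfold y. auto_derive.
    - repeat split; trivial; eexists; eassumption.
    - rewrite (is_derive_unique (fun x => v1 x) _ _ Hl : Derive (fun x => v1 x) r = l).
      change (Derive (fun x => v2 x) r) with (Derive v2 r). field. lra. }
  assert (Hy : forall r, p <= r <= p' -> y r = 0).
  { apply eq_0_of_no_critical; trivial.
    - intros r Hr. apply Hcy, Hpos. apply Hin in Hr. lra.
    - intros r Hr Hyr. destruct (Hin r) as [I1 I2]. specialize (I2 Hr).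
      assert (I3 : Rabs (r - r0) < Rmin d0 d1) by (apply I1; lra).
      assert (Hr' : 0 < r) by (apply Hpos; lra).
      exists (Derive v1 r - Derive v2 r + (c1 - c2) / r). split.
      + apply Hdy; trivial; [lra|]. apply Hgood; [lra | now right].
      + intros E. apply (HG1 r); [lra|]. unfold G.
        replace (r * Derive v1 r - r * Derive v2 r + (c1 - c2)) with
          (r * (Derive v1 r - Derive v2 r + (c1 - c2) / r)) by (field; lra).
        rewrite E. ring. }
  set (m := (p + p') / 2).
  assert (Hm : p < m < p') by (unfold m; lra).
  destruct (Hin m) as [I1 I2]. specialize (I2 Hm).
  assert (I3 : Rabs (m - r0) < Rmin d0 d1) by (apply I1; lra).
  assert (Hm' : 0 < m) by (apply Hpos; lra).
  (* Since [y] vanishes near [m], [v1] inherits differentiability from [v2] and the logarithm, with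
     the derivative that makes [G m = 0]. *)
  assert (Hv1 : is_derive v1 m (Derive v2 m - (c1 - c2) / m)).
  { apply is_derive_ext_loc with (fun r => v2 r - (c1 - c2) * ln r + ln tau).
    - assert (Hloc : locally m (fun r => p < r < p')).
      { apply filter_and; [apply open_gt | apply open_lt]; lra. }
      apply filter_imp with (2 := Hloc). intros r Hr.
      specialize (Hy r ltac:(lra)). unfold y in Hy. lra.
    - assert (H2 : is_derive v2 m (Derive v2 m)) by (apply Hv2; lra). auto_derive.
      + repeat split; trivial; eexists; eassumption.
      + change (Derive (fun x => v2 x) m) with (Derive v2 m). field; lra. }
  apply (HG1 m); [lra|]. unfold G. rewrite (is_derive_unique _ _ _ Hv1). field. lra.
Qed.

(** * From radial solutions to flux orbits *)

Lemma rpow_pos (r a : R) : 0 < r -> rpow r a = exp (a * ln r).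
Proof. intros H. unfold rpow. destruct (Rle_dec r 0); [lra | reflexivity]. Qed.

(** By the product rule the right-hand side is [v' + r v''] with [Derive v] for [v'], and both terms
    are continuous. *)
Lemma C0_C2_rhs_continuous (v g : R -> R) (r : R) :
  C0_C2 v -> (forall s, 0 < s -> is_derive (fun u => u * Derive v u) s (g s)) -> 0 < r ->
  continuous g r.
Proof.
  intros [_ Hv] Hg Hr.
  apply continuous_ext_loc with (fun s => Derive v s + s * Derive_n v 2 s).
  - apply filter_imp with (2 := locally_pos r Hr). intros s Hs.
    destruct (Hv s Hs) as [[l Hl] _]. change (is_derive (Derive v) s l) in Hl.
    pose proof (is_derive_unique _ _ _ (Hg s Hs)) as E. rewrite <- E.
    symmetry. apply is_derive_unique.
    change (Derive_n v 2 s) with (Derive (Derive v) s). rewrite (is_derive_unique _ _ _ Hl).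
    pose proof (is_derive_mult (fun u : R => u) (Derive v) s 1 l (is_derive_id s) Hl Rmult_comm) as P.
    change (is_derive (fun u => u * Derive v u) s (1 * Derive v s + s * l)) in P.
    now rewrite Rmult_1_l in P.
  - destruct (Hv r Hr) as [H1 H2].
    apply (continuous_plus (Derive v) (fun s => s * Derive_n v 2 s)).
    + exact (ex_derive_continuous (Derive v) r H1).
    + apply (continuous_mult (fun s => s) (Derive_n v 2)); trivial. apply continuous_id.
Qed.

Lemma continuous_of_density (c : R) (v : R -> R) (r : R) :
  0 < r -> continuous (density c v) r -> continuous v r.
Proof.
  intros Hr Hd.
  apply continuous_ext_loc with (fun s => ln (density c v s) - c * ln s).
  - apply filter_forall. intros s. unfold density. rewrite ln_exp. simpl; ring.
  - apply (continuous_minus (fun s => ln (density c v s)) (fun s => c * ln s)).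
    + apply (continuous_comp (density c v) ln); trivial.
      apply (ex_derive_continuous ln). auto_derive. apply exp_pos.
    + apply (ex_derive_continuous (fun s => c * ln s)). auto_derive; trivial.
Qed.

Lemma density_continuous (c : R) (v : R -> R) (r : R) :
  0 < r -> continuous v r -> continuous (density c v) r.
Proof.
  intros Hr Hv. apply (continuous_comp (fun s => c * ln s + v s) exp).
  - apply (continuous_plus (fun s => c * ln s) v); trivial.
    apply (ex_derive_continuous (fun s => c * ln s)). auto_derive; trivial.
  - apply (ex_derive_continuous exp). auto_derive; trivial.
Qed.

Lemma exp_at_right_0 : filterlim exp (Rbar_locally' m_infty) (at_right 0).
Proof.
  intros P [d Hd]. exists (ln d). intros t Ht. apply Hd; [|apply exp_pos].
  change (Rabs (exp t - 0) < d). rewrite Rminus_0_r, Rabs_pos_eq by (left; apply exp_pos).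
  rewrite <- (exp_ln d) by apply cond_pos. now apply exp_increasing.
Qed.

Lemma is_lim_comp_exp_m (g : R -> R) (l : R) :
  filterlim g (at_right 0) (locally l) -> is_lim (fun t => g (exp t)) m_infty l.
Proof. intros H. exact (filterlim_comp _ _ _ _ _ _ _ _ exp_at_right_0 H). Qed.

Lemma is_lim_comp_exp_p (g : R -> R) (l : R) :
  is_lim g p_infty l -> is_lim (fun t => g (exp t)) p_infty l.
Proof. intros H. exact (filterlim_comp _ _ _ _ _ _ _ _ is_lim_exp_p H). Qed.

Lemma is_derive_comp_exp (f : R -> R) (t l : R) :
  is_derive f (exp t) l -> is_derive (fun s => f (exp s)) t (exp t * l).
Proof.
  intros H. apply (is_derive_comp f exp t l (exp t)); trivial. apply is_derive_exp.
Qed.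

(** The primitive is [RInt f 0]; integrability on [[0, r]] is inherited from the long intervals in
    the improper integral. The value [f 0] is treated apart, because [density] uses the default
    value of [ln] there. *)
Lemma flux_primitive (c : R) (v f : R -> R) (beta : R) :
  0 <= c -> f 0 = 0 -> (forall r, 0 < r -> f r = density c v r) ->
  (forall r, 0 < r -> continuous v r) ->
  filterlim v (at_right 0) (locally (v 0)) ->
  is_RInt_gen f (at_point 0) (Rbar_locally p_infty) beta ->
  exists M : R -> R,
    (forall r, 0 < r -> is_derive M r (density c v r)) /\
    filterlim M (at_right 0) (locally 0) /\ is_lim M p_infty beta.
Proof.
  intros Hc Hf0 Hf Hv Hv0 Hint.
  assert (Hev : forall eps : posreal, exists A, forall r, A < r ->
            exists y, is_RInt f 0 r y /\ Rabs (y - beta) < eps).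
  { intros eps. destruct (Hint (ball beta eps) (locally_ball beta eps)) as [Q R0 HQ [A HA] HH].
    exists A. intros r Hr. exact (HH 0 r HQ (HA r Hr)). }
  assert (Hex : forall r, 0 <= r -> ex_RInt f 0 r).
  { intros r Hr. destruct (Hev (mkposreal 1 Rlt_0_1)) as [A HA].
    pose proof (Rmax_l A r). pose proof (Rmax_r A r).
    destruct (HA (Rmax A r + 1)) as [y [Hy _]]; [lra|].
    apply (ex_RInt_Chasles_1 f 0 r (Rmax A r + 1)); [lra | now exists y]. }
  exists (RInt f 0). split; [|split].
  - intros r Hr. rewrite <- Hf by trivial. apply is_derive_RInt with 0.
    + apply filter_imp with (2 := locally_pos r Hr).
      intros s Hs. apply (RInt_correct f 0 s), Hex. now left.
    + apply continuous_ext_loc with (density c v).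
      * apply filter_imp with (2 := locally_pos r Hr). intros s Hs. now rewrite Hf.
      * apply density_continuous; auto.
  - apply filterlim_locally. intros eps.
    destruct (proj1 (filterlim_locally _ _) Hv0 (mkposreal 1 Rlt_0_1)) as [d Hd].
    (* A bound for the integrand near 0: there [v s < v 0 + 1], and [c * ln s <= 0] because [s < 1]
       and [0 <= c]. *)
    set (K := exp (v 0 + 1)).
    assert (HK : 0 < K) by apply exp_pos.
    assert (Hd' : 0 < Rmin (Rmin d 1) (eps / K)).
    { repeat apply Rmin_pos; [apply cond_pos | lra |].
      apply Rdiv_lt_0_compat; [apply cond_pos | trivial]. }
    exists (mkposreal _ Hd'). intros r Hr Hr0.
    change (Rabs (r - 0) < Rmin (Rmin d 1) (eps / K)) in Hr.
    rewrite Rminus_0_r, Rabs_pos_eq in Hr by lra.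
    pose proof (Rmin_l (Rmin d 1) (eps / K)). pose proof (Rmin_r (Rmin d 1) (eps / K)).
    pose proof (Rmin_l d 1). pose proof (Rmin_r d 1).
    change (Rabs (RInt f 0 r - 0) < eps). rewrite Rminus_0_r.
    apply Rle_lt_trans with ((r - 0) * K).
    + apply abs_RInt_le_const; [lra | apply Hex; lra |].
      intros s [Hs1 Hs2]. destruct Hs1 as [Hs1|<-]; [|rewrite Hf0, Rabs_R0; lra].
      rewrite Hf by trivial. unfold density. rewrite Rabs_pos_eq by (left; apply exp_pos).
      assert (Hvs : Rabs (v s - v 0) < 1).
      { apply (Hd s); trivial. change (Rabs (s - 0) < d).
        rewrite Rminus_0_r, Rabs_pos_eq; lra. }
      apply Rabs_def2 in Hvs.
      assert (ln s < ln 1) by (apply ln_increasing; lra). rewrite ln_1 in *.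
      left. apply exp_increasing. nra.
    + rewrite Rminus_0_r. apply Rmult_lt_reg_r with (/ K); [now apply Rinv_0_lt_compat|].
      rewrite Rinv_r_simpl_l by lra. unfold Rdiv in *. lra.
  - apply is_lim_spec. intros eps. destruct (Hev eps) as [A HA].
    exists A. intros r Hr. destruct (HA r Hr) as [y [Hy1 Hy2]].
    now rewrite (is_RInt_unique _ _ _ _ Hy1).
Qed.

Lemma flux_primitive_pos (c : R) (v M : R -> R) (r : R) :
  (forall r, 0 < r -> is_derive M r (density c v r)) ->
  filterlim M (at_right 0) (locally 0) -> 0 < r -> 0 < M r.
Proof.
  intros Hd Hl Hr. rewrite <- (exp_ln r) by trivial.
  apply (increasing_gt_lim (fun t => M (exp t))); [|now apply is_lim_comp_exp_m].
  apply increasing_of_derive with (fun t => exp t * density c v (exp t)).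
  - intros t. apply is_derive_comp_exp, Hd, exp_pos.
  - intros t. apply Rmult_lt_0_compat; apply exp_pos.
Qed.

(* The flux condition at infinity removes the constant of integration. *)
Lemma scaled_derivative_eq (c1 c2 tau beta1 beta2 : R) (v1 v2 M1 M2 : R -> R) (r : R) :
  (forall r, 0 < r -> is_derive (fun s => s * Derive v1 s) r
     (- (density c1 v1 r - tau * density c2 v2 r))) ->
  (forall r, 0 < r -> is_derive M1 r (density c1 v1 r)) ->
  (forall r, 0 < r -> is_derive M2 r (density c2 v2 r)) ->
  is_lim M1 p_infty beta1 -> is_lim M2 p_infty beta2 ->
  is_lim (fun r => r * Derive v1 r) p_infty (- (beta1 - tau * beta2)) ->
  0 < r -> r * Derive v1 r = - M1 r + tau * M2 r.
Proof.
  intros HS HM1 HM2 L1 L2 LS Hr.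
  set (F := fun s => s * Derive v1 s + (M1 s - tau * M2 s)).
  enough (H : F (exp (ln r)) = 0) by (rewrite exp_ln in H by trivial; unfold F in H; lra).
  apply (zero_of_derive_zero_lim (fun t => F (exp t)) p_infty).
  - intros t. replace 0 with (exp t * 0) by ring. apply (is_derive_comp_exp F).
    pose proof (exp_pos t) as Ht. set (s := exp t) in *.
    replace 0 with (- (density c1 v1 s - tau * density c2 v2 s)
      + (density c1 v1 s - tau * density c2 v2 s)) by ring.
    apply (is_derive_plus (fun s => s * Derive v1 s) (fun s => M1 s - tau * M2 s)); auto.
    apply (is_derive_minus M1 (fun s => tau * M2 s)); auto.
    apply (is_derive_scal M2); auto.
  - apply is_lim_comp_exp_p. replace 0 with (- (beta1 - tau * beta2) + (beta1 - tau * beta2)) by ring.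
    apply is_lim_plus'; trivial. limit.
Qed.

Lemma is_derive_scaled_density (b : R) (v : R -> R) (t : R) :
  is_derive v (exp t) (Derive v (exp t)) ->
  is_derive (fun s => exp (2 * b * s) * exp (v (exp s))) t
    (exp (2 * b * t) * exp (v (exp t)) * (2 * b + exp t * Derive v (exp t))).
Proof.
  intros Hv. auto_derive.
  - repeat split. now exists (Derive v (exp t)).
  - change (Derive (fun x => v x) (exp t)) with (Derive v (exp t)). ring.
Qed.

Lemma scaled_density_eq (c b : R) (v : R -> R) (t : R) :
  c + 1 = 2 * b -> exp t * density c v (exp t) = exp (2 * b * t) * exp (v (exp t)).
Proof.
  intros H. unfold density. rewrite ln_exp, <- !exp_plus. f_equal. rewrite <- H. ring.
Qed.

Lemma is_lim_scaled_density (b : R) (v : R -> R) :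
  0 < b -> filterlim v (at_right 0) (locally (v 0)) ->
  is_lim (fun t => exp (2 * b * t) * exp (v (exp t))) m_infty 0.
Proof.
  intros Hb Hv. replace 0 with (0 * exp (v 0)) by ring. apply is_lim_mult_finite.
  - apply (is_lim_comp exp (fun t => 2 * b * t) m_infty 0 m_infty).
    + apply is_lim_exp_m.
    + evar_last; [apply is_lim_scal_l, is_lim_id|].
      simpl. destruct (Rle_dec 0 (2 * b)) as [H|H]; [|lra].
      destruct (Rle_lt_or_eq_dec 0 (2 * b) H); [reflexivity | lra].
    + exists 0. intros; discriminate.
  - apply (is_lim_comp_continuous (fun t => v (exp t)) exp).
    + now apply is_lim_comp_exp_m.
    + apply (ex_derive_continuous exp). auto_derive; trivial.
Qed.

Lemma radial_solution_orbit N tau v1 v2 beta1 beta2 :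
  0 < N -> 0 < tau < 1 -> radial_solution N tau v1 v2 beta1 beta2 ->
  exists M1 M2 p1 p2, flux_orbit (N + 1) 1 tau M1 M2 p1 p2 beta1 beta2.
Proof.
  intros HN Htau [R1 [R2 [E1 [E2 [_ [_ [I1 [I2 [L1 L2]]]]]]]]].
  set (c := 2 * N + 1) in *.
  assert (F1 : forall r, 0 < r -> rpow r c * exp (v1 r) = density c v1 r).
  { intros r Hr. rewrite rpow_pos by trivial. now rewrite <- exp_plus. }
  assert (F2 : forall r, 0 < r -> r * exp (v2 r) = density 1 v2 r).
  { intros r Hr. unfold density. now rewrite Rmult_1_l, exp_plus, exp_ln. }
  assert (E1' : forall r, 0 < r -> is_derive (fun s => s * Derive v1 s) r
     (- (density c v1 r - tau * density 1 v2 r))).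
  { intros r Hr. rewrite <- F1, <- F2, <- Rmult_assoc by trivial. now apply E1. }
  assert (E2' : forall r, 0 < r -> is_derive (fun s => s * Derive v2 s) r
     (- (density 1 v2 r - tau * density c v1 r))).
  { intros r Hr. rewrite <- F1, <- F2, <- Rmult_assoc by trivial. now apply E2. }
  (* The determinant of the coupling. Inverting it writes each density as a combination of the two
     continuous right-hand sides, and a logarithm then gives continuity of [v1] and [v2]. *)
  assert (Ht : 1 - tau ^ 2 <> 0) by nra.
  assert (C1 : forall r, 0 < r -> continuous v1 r).
  { intros r Hr. apply continuous_of_density with c; trivial.
    apply continuous_ext with (fun s => (- / (1 - tau ^ 2))
      * (- (density c v1 s - tau * density 1 v2 s)
         + tau * - (density 1 v2 s - tau * density c v1 s))).
    - intros s. simpl. field. intros E. apply Ht. rewrite <- E. ring.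
    - apply (continuous_scal_r (- / (1 - tau ^ 2))
        (fun s => - (density c v1 s - tau * density 1 v2 s)
         + tau * - (density 1 v2 s - tau * density c v1 s))).
      apply (continuous_plus (fun s => - (density c v1 s - tau * density 1 v2 s))
        (fun s => tau * - (density 1 v2 s - tau * density c v1 s))).
      + now apply (C0_C2_rhs_continuous v1).
      + apply (continuous_scal_r tau (fun s => - (density 1 v2 s - tau * density c v1 s))).
        now apply (C0_C2_rhs_continuous v2). }
  assert (C2 : forall r, 0 < r -> continuous v2 r).
  { intros r Hr. apply continuous_of_density with 1; trivial.
    apply continuous_ext with (fun s => (- / (1 - tau ^ 2))
      * (tau * - (density c v1 s - tau * density 1 v2 s)
         + - (density 1 v2 s - tau * density c v1 s))).
    - intros s. simpl. field. intros E. apply Ht. rewrite <- E. ring.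
    - apply (continuous_scal_r (- / (1 - tau ^ 2))
        (fun s => tau * - (density c v1 s - tau * density 1 v2 s)
         + - (density 1 v2 s - tau * density c v1 s))).
      apply (continuous_plus (fun s => tau * - (density c v1 s - tau * density 1 v2 s))
        (fun s => - (density 1 v2 s - tau * density c v1 s))).
      + apply (continuous_scal_r tau (fun s => - (density c v1 s - tau * density 1 v2 s))).
        now apply (C0_C2_rhs_continuous v1).
      + now apply (C0_C2_rhs_continuous v2). }
  destruct (flux_primitive c v1 (fun r => rpow r c * exp (v1 r)) beta1)
    as [M1 [D1 [Z1 B1]]]; trivial.
  { unfold c; lra. }
  { unfold rpow. destruct (Rle_dec 0 0); [ring | lra]. }
  { apply R1. }
  destruct (flux_primitive 1 v2 (fun r => r * exp (v2 r)) beta2)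
    as [M2 [D2 [Z2 B2]]]; trivial; try lra.
  { apply R2. }
  assert (S1 : forall r, 0 < r -> r * Derive v1 r = - M1 r + tau * M2 r).
  { intros r. apply (scaled_derivative_eq c 1 tau beta1 beta2 v1 v2); trivial. }
  assert (S2 : forall r, 0 < r -> r * Derive v2 r = - M2 r + tau * M1 r).
  { intros r. apply (scaled_derivative_eq 1 c tau beta2 beta1 v2 v1); trivial. }
  assert (W : weak_system c 1 tau v1 v2).
  { constructor; trivial.
    - intros r Hr. apply (ex_derive_continuous (Derive v1)). now apply R1.
    - intros r Hr. apply (ex_derive_continuous (Derive v2)). now apply R2.
    (* If both derivatives vanished, [M1 = tau M2] and [M2 = tau M1] would give
       [(1 - tau ^ 2) M1 = 0], against [0 < M1]. *)
    - intros r Hr. destruct (Req_dec (Derive v1 r) 0) as [H1|]; [right|now left].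
      intros H2. specialize (S1 r Hr). specialize (S2 r Hr). rewrite H1 in S1. rewrite H2 in S2.
      pose proof (flux_primitive_pos c v1 M1 r D1 Z1 Hr).
      assert (0 < (1 - tau) * (1 + tau)) by (apply Rmult_lt_0_compat; lra). nra. }
  assert (V1 : forall r, 0 < r -> is_derive v1 r (Derive v1 r)).
  { intros r. now apply (weak_system_is_derive c 1 tau v1 v2). }
  assert (V2 : forall r, 0 < r -> is_derive v2 r (Derive v2 r)).
  { intros r. apply (weak_system_is_derive 1 c tau v2 v1). destruct W as [? ? ? ? ? ? ? Hnd]; constructor; trivial.
    intros s Hs. destruct (Hnd s Hs); auto. }
  assert (Hc : c + 1 = 2 * (N + 1)) by (unfold c; ring).
  exists (fun t => M1 (exp t)), (fun t => M2 (exp t)),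
    (fun t => exp (2 * (N + 1) * t) * exp (v1 (exp t))),
    (fun t => exp (2 * 1 * t) * exp (v2 (exp t))).
  constructor; trivial; try lra.
  - intros t. apply Rmult_lt_0_compat; apply exp_pos.
  - intros t. apply Rmult_lt_0_compat; apply exp_pos.
  - intros t. rewrite <- (scaled_density_eq c) by trivial.
    apply is_derive_comp_exp, D1, exp_pos.
  - intros t. rewrite <- (scaled_density_eq 1) by ring.
    apply is_derive_comp_exp, D2, exp_pos.
  - intros t. replace (2 * (N + 1) - M1 (exp t) + tau * M2 (exp t))
      with (2 * (N + 1) + exp t * Derive v1 (exp t)) by (rewrite S1 by apply exp_pos; ring).
    apply is_derive_scaled_density, V1, exp_pos.
  - intros t. replace (2 * 1 - M2 (exp t) + tau * M1 (exp t))
      with (2 * 1 + exp t * Derive v2 (exp t)) by (rewrite S2 by apply exp_pos; ring).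
    apply is_derive_scaled_density, V2, exp_pos.
  - now apply is_lim_comp_exp_m.
  - now apply is_lim_comp_exp_m.
  - apply is_lim_scaled_density; [lra | apply R1].
  - apply is_lim_scaled_density; [lra | apply R2].
  - now apply is_lim_comp_exp_p.
  - now apply is_lim_comp_exp_p.
Qed.

(** * The arc of the conic *)

Definition on_conic (a b tau x y : R) : Prop :=
  x ^ 2 - 2 * tau * x * y + y ^ 2 = 4 * a * x + 4 * b * y.

(** With [X = 4 a + 8 tau b] and [Y = 8 tau (a + 2 tau b)], the conic polynomial at [(X, y)] factors
    as [(y - 4 b) (y - Y)]. It is at least the value 0 at [(x, y)], because [2 a + tau y <= x <= X]
    and the polynomial increases in its first argument beyond [2 a + tau y]. *)
Lemma conic_star_le (a b tau x y : R) :
  on_conic a b tau x y -> 2 * a - x + tau * y <= 0 ->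
  4 * b < y -> x <= 4 * a + 8 * tau * b -> 8 * tau * (a + 2 * tau * b) <= y.
Proof.
  unfold on_conic. intros Hc Hx Hy Hle. apply Rnot_lt_le. intros Hn.
  set (X := 4 * a + 8 * tau * b) in *.
  assert (H1 : 0 <= (X - x) * (X + x - 2 * tau * y - 4 * a)) by (apply Rmult_le_pos; lra).
  assert (H2 : 0 < (y - 4 * b) * (8 * tau * (a + 2 * tau * b) - y)) by (apply Rmult_lt_0_compat; lra).
  unfold X in *. nra.
Qed.

(** The point [(X, Y)] lies on the conic, and the last two hypotheses say that the gradient of the
    conic polynomial there has nonnegative entries. Its quadratic part is positive definite, so the
    polynomial is positive when [X <= x] and [Y < y]. *)
Lemma conic_star_ge (a b tau x y : R) :
  0 < tau < 1 ->
  on_conic a b tau x y ->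
  4 * a + 8 * tau * b <= x ->
  2 * a + tau * (8 * tau * (a + 2 * tau * b)) <= 4 * a + 8 * tau * b ->
  2 * b + tau * (4 * a + 8 * tau * b) <= 8 * tau * (a + 2 * tau * b) ->
  y <= 8 * tau * (a + 2 * tau * b).
Proof.
  unfold on_conic. intros Ht Hc Hx H1 H2.
  apply Rnot_lt_le. intros Hn.
  set (X := 4 * a + 8 * tau * b) in *. set (Y := 8 * tau * (a + 2 * tau * b)) in *.
  assert (G1 : 0 <= (x - X) * (2 * X - 2 * tau * Y - 4 * a)) by (apply Rmult_le_pos; lra).
  assert (G2 : 0 <= (y - Y) * (2 * Y - 2 * tau * X - 4 * b)) by (apply Rmult_le_pos; lra).
  assert (G3 : 0 < (1 - tau) * ((y - Y) * (y - Y))) by (repeat apply Rmult_lt_0_compat; lra).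
  assert (G4 : 0 <= tau * ((x - X - (y - Y)) * (x - X - (y - Y)))).
  { apply Rmult_le_pos; [lra | apply Rle_0_sqr]. }
  assert (G5 : 0 <= (1 - tau) * ((x - X) * (x - X))).
  { apply Rmult_le_pos; [lra | apply Rle_0_sqr]. }
  assert (G6 : X ^ 2 - 2 * tau * X * Y + Y ^ 2 = 4 * a * X + 4 * b * Y) by (unfold X, Y; ring).
  nra.
Qed.

Lemma conic_larger_root (a b tau x y : R) :
  on_conic a b tau x y -> 2 * b - y + tau * x <= 0 ->
  y = 2 * b + tau * x + sqrt ((2 * b + tau * x) ^ 2 - x * (x - 4 * a)).
Proof.
  unfold on_conic. intros Hc Hy.
  replace ((2 * b + tau * x) ^ 2 - x * (x - 4 * a)) with (Rsqr (y - (2 * b + tau * x)))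
    by (unfold Rsqr; lra).
  rewrite sqrt_Rsqr; lra.
Qed.

(** The bound is the rightmost abscissa of the ellipse. Completing squares turns the conic into [z ^
    2 + (1 - tau ^ 2) (y - (2 b + tau x)) ^ 2 / 4 = D]. *)
Lemma conic_le_bar (a b tau x y : R) :
  0 < tau < 1 -> on_conic a b tau x y ->
  x <= 2 / (1 - tau ^ 2) * (a + tau * b + sqrt (a ^ 2 + 2 * tau * a * b + b ^ 2)).
Proof.
  unfold on_conic. intros Ht Hc.
  assert (Hk : 0 < 1 - tau ^ 2) by nra.
  set (D := a ^ 2 + 2 * tau * a * b + b ^ 2).
  set (z := (1 - tau ^ 2) * x / 2 - (a + tau * b)).
  assert (Hz : z ^ 2 <= D).
  { enough (0 <= D - z ^ 2) by lra.
    replace (D - z ^ 2) with ((1 - tau ^ 2) * (y - (2 * b + tau * x)) ^ 2 / 4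
       + (1 - tau ^ 2) / 4 * (4 * a * x + 4 * b * y - (x ^ 2 - 2 * tau * x * y + y ^ 2)))
      by (unfold D, z; field).
    rewrite Hc, Rminus_diag, Rmult_0_r, Rplus_0_r.
    pose proof (pow2_ge_0 (y - (2 * b + tau * x))).
    apply Rmult_le_pos; [apply Rmult_le_pos|]; lra. }
  assert (Hs : z <= sqrt D).
  { apply Rle_trans with (Rabs z); [apply Rle_abs|].
    rewrite <- sqrt_Rsqr_abs. apply sqrt_le_1_alt. unfold Rsqr. lra. }
  apply Rmult_le_reg_l with ((1 - tau ^ 2) / 2); [lra|].
  replace ((1 - tau ^ 2) / 2 * (2 / (1 - tau ^ 2) * (a + tau * b + sqrt D)))
    with (a + tau * b + sqrt D) by (field; lra).
  unfold z in Hs. lra.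
Qed.

(* [p / t^2] is decreasing for [p = m + 4 n t - 4 m t^2 - 8 n t^3]. *)
Lemma cubic_nonneg_before_zero (m n t t0 : R) :
  0 < m -> 0 < n -> 0 < t < t0 ->
  2 * (1 - 2 * t0 ^ 2) * (m + 2 * t0 * n) - m = 0 ->
  0 <= 2 * (1 - 2 * t ^ 2) * (m + 2 * t * n) - m.
Proof.
  intros Hm Hn Ht H0.
  apply Rmult_le_reg_r with (t0 ^ 2); [nra|]. rewrite Rmult_0_l.
  replace ((2 * (1 - 2 * t ^ 2) * (m + 2 * t * n) - m) * t0 ^ 2) with
    ((2 * (1 - 2 * t0 ^ 2) * (m + 2 * t0 * n) - m) * t ^ 2
     + (t0 - t) * (m * (t0 + t) + 4 * n * t * t0 + 8 * n * (t * t0) ^ 2)) by ring.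
  rewrite H0, Rmult_0_l, Rplus_0_l.
  assert (0 <= m * (t0 + t)) by (apply Rmult_le_pos; lra).
  assert (0 <= 4 * n * t * t0) by (repeat apply Rmult_le_pos; lra).
  assert (0 <= 8 * n * (t * t0) ^ 2) by (apply Rmult_le_pos; [lra | apply pow2_ge_0]).
  apply Rmult_le_pos; lra.
Qed.

(** * The cases [tau < 1/2] and [tau > 1/2] *)

Lemma orbit_small_tau a b tau M1 M2 p1 p2 beta1 beta2 :
  flux_orbit a b tau M1 M2 p1 p2 beta1 beta2 -> tau < / 2 ->
  beta1 <= 4 * a + 8 * tau * b /\ 4 * a < beta1 /\ 8 * tau * (a + 2 * tau * b) <= beta2 /\
  0 < beta1 <= 2 / (1 - tau ^ 2) * (a + tau * b + sqrt (a ^ 2 + 2 * tau * a * b + b ^ 2)) /\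
  beta2 = 2 * b + tau * beta1 + sqrt ((2 * b + tau * beta1) ^ 2 - beta1 * (beta1 - 4 * a)).
Proof.
  intros orbit Ht.
  pose proof (flux_orbit_swap _ _ _ _ _ _ _ _ _ orbit) as orbit'.
  pose proof (orbit_beta1_star _ _ _ _ _ _ _ _ _ orbit) as Hs.
  pose proof (orbit_beta1_gt _ _ _ _ _ _ _ _ _ orbit) as G1.
  pose proof (orbit_beta1_gt _ _ _ _ _ _ _ _ _ orbit') as G2.
  pose proof (orbit_exit _ _ _ _ _ _ _ _ _ orbit) as X1.
  pose proof (orbit_exit _ _ _ _ _ _ _ _ _ orbit') as X2.
  destruct (orbit_conic _ _ _ _ _ _ _ _ _ orbit) as [Hc _].
  destruct orbit as [Ha Hb Htau _ _ _ _ _ _ _ _ _ _ _ _].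
  assert (Hle : beta1 <= 4 * a + 8 * tau * b) by (apply Rnot_lt_le; intros H; nra).
  repeat split; trivial; try lra.
  - now apply conic_star_le with beta1.
  - now apply conic_le_bar with beta2.
  - now apply conic_larger_root.
Qed.

(** Of the two gradient conditions at the star point, the first is twice the cubic inequality at
    [tau], and the second follows from [1/2 < tau]. *)
Lemma orbit_large_tau a b tau t0 M1 M2 p1 p2 beta1 beta2 :
  flux_orbit a b tau M1 M2 p1 p2 beta1 beta2 -> / 2 < tau < t0 ->
  2 * (1 - 2 * t0 ^ 2) * (a + 2 * t0 * b) - a = 0 ->
  beta2 <= 8 * tau * (a + 2 * tau * b) /\ 4 * a + 8 * tau * b <= beta1.
Proof.
  intros orbit Ht H0.
  pose proof (orbit_beta1_star _ _ _ _ _ _ _ _ _ orbit) as Hs.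
  destruct (orbit_conic _ _ _ _ _ _ _ _ _ orbit) as [Hc _].
  destruct orbit as [Ha Hb Htau _ _ _ _ _ _ _ _ _ _ _ _].
  assert (Hle : 4 * a + 8 * tau * b <= beta1) by (apply Rnot_lt_le; intros H; nra).
  split; trivial.
  assert (Hp := cubic_nonneg_before_zero a b tau t0 Ha Hb ltac:(lra) H0).
  apply conic_star_ge with beta1; trivial.
  - lra.
  - assert (0 < (2 * tau - 1) * (2 * tau + 1) * b) by (repeat apply Rmult_lt_0_compat; lra).
    assert (0 < tau * a) by (apply Rmult_lt_0_compat; lra).
    lra.
Qed.

Theorem mainTheorem6 (N tau : R) (v1 v2 : R -> R) (beta1 beta2 : R) :
  0 < N -> 0 < tau < 1 ->
  radial_solution N tau v1 v2 beta1 beta2 ->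
  (tau < 1/2 ->
     beta1 <= beta1_star N tau /\ beta2 <= beta2_star N tau /\
     (0 < beta1 <= beta1_bar N tau /\ beta2 = phi1p N tau beta1 /\
      Rmax (beta2_sstar N tau) 4 <= beta2) /\
     (0 < beta2 <= beta2_bar N tau /\ beta1 = phi2p N tau beta2 /\
      Rmax (beta1_sstar N tau) (4 * (N + 1)) <= beta1)) /\
  (forall t12, 0 < t12 -> tau12_poly N t12 = 0 ->
     1/2 < tau < t12 ->
     beta2 <= beta2_sstar N tau /\
     beta1_star N tau <= beta1 /\ 4 * (N + 1) < beta1_star N tau) /\
  (forall t11, 0 < t11 -> tau11_poly N t11 = 0 ->
     1/2 < tau < t11 ->
     beta1 <= beta1_sstar N tau /\
     beta2_star N tau <= beta2 /\ 4 < beta2_star N tau).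
Proof.
  intros HN Htau Hsol.
  destruct (radial_solution_orbit N tau v1 v2 beta1 beta2 HN Htau Hsol)
    as [M1 [M2 [p1 [p2 orbit]]]].
  (* The exchanged orbit has [a = 1] and [b = N + 1], which turns [tau12_poly] into [tau11_poly] and
     yields the mirrored bounds. *)
  pose proof (flux_orbit_swap _ _ _ _ _ _ _ _ _ orbit) as orbit'.
  unfold beta1_star, beta2_star, beta1_sstar, beta2_sstar, tau11_poly, tau12_poly,
    beta1_bar, beta2_bar, phi1p, phi2p, Dd.
  split; [|split].
  - intros Ht.
    destruct (orbit_small_tau _ _ _ _ _ _ _ _ _ orbit) as [A1 [A2 [A3 [A4 A5]]]]; [lra|].
    destruct (orbit_small_tau _ _ _ _ _ _ _ _ _ orbit') as [B1 [B2 [B3 [B4 B5]]]]; [lra|].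
    replace (1 ^ 2 + 2 * tau * 1 * (N + 1) + (N + 1) ^ 2)
      with ((N + 1) ^ 2 + 2 * tau * (N + 1) + 1) in B4 by ring.
    replace ((N + 1) ^ 2 + 2 * tau * (N + 1) * 1 + 1 ^ 2)
      with ((N + 1) ^ 2 + 2 * tau * (N + 1) + 1) in A4 by ring.
    rewrite !Rmult_1_r in *.
    repeat split; try lra; try (apply Rmax_lub; lra).
  - intros t12 _ H0 Ht.
    destruct (orbit_large_tau _ _ _ t12 _ _ _ _ _ _ orbit); lra.
  - intros t11 _ H0 Ht.
    destruct (orbit_large_tau _ _ _ t11 _ _ _ _ _ _ orbit'); [lra | lra |].
    assert (0 < tau * (N + 1)) by (apply Rmult_lt_0_compat; lra). lra.
Qed.
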